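(* Let $\alpha\in[\frac13,1)$ and let $A=\{A_n\}_{n\ge 0}$ be a finitely supported complex sequence with $A_0=0$. Then for any decreasing sequence $\{q_n\}_{n\ge1}$ of positive real numbers, with $Q_n=q_1+q_2+\cdots+q_n$ for $n\ge1$, $$\sum_{n=1}^{\infty}\frac{Q_n^{\alpha}|A_n-A_{n-1}|^2}{q_n}\ \ge\ \sum_{n=1}^{\infty}w_n(q,Q)|A_n|^2\ >\ \frac{(\alpha-1)^2}{4}\sum_{n=1}^{\infty}\frac{q_n}{Q_n^{2-\alpha}}|A_n|^2,$$ where, for $n\ge1$, $$w_n(q,Q)=\frac{Q_n^{\alpha}}{q_n}\Big[1+\frac{q_n}{q_{n+1}}\Big(1+\frac{q_{n+1}}{Q_n}\Big)^{\alpha}-\Big(1-\frac{q_n}{Q_n}\Big)^{\frac{1-\alpha}{2}}-\frac{q_n}{q_{n+1}}\Big(1+\frac{q_{n+1}}{Q_n}\Big)^{\frac{1+\alpha}{2}}\Big].$$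
   Context: A sequence $\{A_n\}_{n\ge0}$ is finitely supported if $A_n\ne0$ for only finitely many $n$. ''Decreasing'' is meant in the weak sense: $q_{n+1}\le q_n$ for all $n\ge1$.
   Formalization: The strict inequality is asserted only when A is not identically zero, since for A = 0 both sides are 0 and it fails; the first inequality is asserted for every A. *)

(* Defs.v *)
From mathcomp Require Export all_boot all_order all_algebra.
From mathcomp Require Export complex.
From mathcomp Require Export all_classical all_reals all_analysis.

Set Implicit Arguments.
Unset Strict Implicit.
Unset Printing Implicit Defensive.

Import Order.TTheory GRing.Theory Num.Theory.
Import numFieldNormedType.Exports.

Local Open Scope classical_set_scope.
Local Open Scope ring_scope.

(* The library defines this notation only for extended-real series. *)
Notation "\sum_ ( m <= i <oo ) F" :=
  (\big[+%R/0%R]_(m <= i <oo) F%R) : ring_scope.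

(* Sequences indexed by n >= 1 are functions on nat whose value at 0 is
   never used. *)
Definition psum (R : realType) (q : nat -> R) (n : nat) : R :=
  \sum_(1 <= k < n.+1) q k.

(* For n = 1 the base 1 - q n / Q n is 0; powR gives 0 `^ s = 0 for s != 0. *)
Definition weight (R : realType) (alpha : R) (q Q : nat -> R) (n : nat) : R :=
  Q n `^ alpha / q n *
  (1 + q n / q n.+1 * (1 + q n.+1 / Q n) `^ alpha
     - (1 - q n / Q n) `^ ((1 - alpha) / 2)
     - q n / q n.+1 * (1 + q n.+1 / Q n) `^ ((1 + alpha) / 2)).

Definition finitely_supported (R : realType) (A : nat -> R[i]) : Prop :=
  finite_set [set n | A n != 0].

(* The R-valued modulus; the generic norm `|z| on R[i] takes values in R[i]. *)
Definition cmod (R : realType) (z : R[i]) : R := ComplexField.Normc.normc z.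

(* Main.v *)
(** Write [u n = Q n `^ ((1 - alpha) / 2)] and [v n = Q n `^ alpha / q n].  The
    weight is [- div (v grad u) / u], i.e.
    [w n = v n (1 - u (n-1) / u n) + v (n+1) (1 - u (n+1) / u n)], so the first
    inequality is the ground state substitution: AM-GM on every edge, then
    summation.
    For the second one put [s = (1 - alpha) / 2], [x = q n / Q n] and
    [y = q (n+1) / Q n <= x].  After dividing by [Q n `^ (alpha - 1)] the
    pointwise claim is
    [(1 - (1-x)^s) / x - ((1+y)^(1-s) - (1+y)^(1-2s)) / y > s^2 x].
    Second-order Taylor bounds give more than [s + s (1-s) x / 2] for the first
    quotient and at most [s + s (1-3s) y / 2] for the second; since [s <= 1/3]
    and [y <= x], the difference exceeds [s^2 x]. *)
Require Import Defs.
From mathcomp Require Import all_boot all_order all_algebra.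
From mathcomp Require Import complex.
From mathcomp Require Import all_classical all_reals all_analysis.
From mathcomp Require Import ring lra.

Import Order.TTheory GRing.Theory Num.Theory.
Import numFieldNormedType.Exports.

Local Open Scope classical_set_scope.
Local Open Scope ring_scope.

(** * Second-order bounds for real powers *)

Lemma mean_value (R : realType) (f df : R -> R) (a b : R) : a < b ->
    (forall x, a <= x <= b -> is_derive x 1 f (df x)) ->
  exists2 c, a < c < b & f b - f a = df c * (b - a).
Proof.
move=> ab fdf.
have fcont : {within `[a, b], continuous f}.
  apply: derivable_within_continuous => x /[!in_itv]/= xab.
  by have [] := fdf x xab.
have fd x : x \in `]a, b[ -> is_derive x 1 f (df x).
  by rewrite in_itv/= => /andP[ax xb]; apply: fdf; rewrite !ltW.
by have [c /[!in_itv]/=] := MVT ab fd fcont; exists c.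
Qed.

Lemma ln_le_subr1 (R : realType) (z : R) : 0 < z -> ln z <= z - 1.
Proof.
by move=> z0; rewrite lerBrDl -[leRHS](lnK z0) expR_ge1Dx.
Qed.

Lemma powR_expR (R : realType) (z p : R) : 0 < z -> z `^ p = expR (p * ln z).
Proof. by move=> z0; rewrite /powR gt_eqF. Qed.

(** The gap is [f 1 - f (1 - x)], and [df z], that is s (z^(s-1) - 1 - (1-s)(1-z)), is positive on
    (0, 1): exponentiate [ln z <= z - 1]. *)
Lemma powR_lt_quadratic (R : realType) (s x : R) : 0 < s < 1 -> 0 < x <= 1 ->
  (1 - x) `^ s < 1 - s * x - s * (1 - s) / 2 * x ^+ 2.
Proof.
move=> /andP[s0 s1] /andP[x0]; rewrite le_eqVlt => /predU1P[->|x1].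
  (* The endpoint [x = 1] is separate because z^s has no derivative at 0; the claim is then 0 < (1 -
     s)(1 - s/2). *)
  rewrite subrr powR0 ?gt_eqF//; nra.
pose k := s * (1 - s) / 2.
pose f : R -> R := s \*: (cst 1 - id) + k \*: ((cst 1 - id) ^+ 2)
  + (@powR R) ^~ s.
pose df z : R := - s - 2 * k * (1 - z) + s * z `^ (s - 1).
have fdf z : 1 - x <= z <= 1 -> is_derive z 1 f (df z).
  move=> /andP[xz z1]; have z0 : 0 < z by lra.
  have ? := is_derive1_powR s z0.
  apply: is_derive_eq; rewrite /df /GRing.scale/= !fctE /cst expr1; ring.
have [|c /andP[xc c1]] := mean_value R f df (1 - x) 1 _ fdf; first by lra.
have c0 : 0 < c by lra.
have fE w : f w = s * (1 - w) + k * (1 - w) ^+ 2 + w `^ s by [].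
rewrite !fE /df powR1 => E.
have powc : 1 + (1 - s) * (1 - c) < c `^ (s - 1).
  have lnc := ln_le_subr1 R c c0.
  have le : (1 - s) * (1 - c) <= (s - 1) * ln c by nra.
  have gt0 : 0 < (1 - s) * (1 - c) by rewrite mulr_gt0//; lra.
  rewrite powR_expR// (le_lt_trans _ (expR_gt1Dx _)) ?lerD2l// gt_eqF//.
  exact: lt_le_trans le.
have : 0 < s * (c `^ (s - 1) - 1 - (1 - s) * (1 - c)) * x.
  by rewrite !mulr_gt0//; lra.
move: E; rewrite /k; lra.
Qed.

(** The gap is [f (1 + y) - f 1], so [0 <= df c] suffices. With p = c^(-s) this comes from 1 - p <=
    s (c - 1), a form of [ln c <= c - 1]; multiplying it by 1 - 3s uses [s <= 1 / 3]. *)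
Lemma powR_sub_le_quadratic (R : realType) (s y : R) :
    0 < s <= 1 / 3 -> 0 < y ->
  (1 + y) `^ (1 - s) - (1 + y) `^ (1 - 2 * s) <=
  s * y + s * (1 - 3 * s) / 2 * y ^+ 2.
Proof.
move=> /andP[s0 s1] y0.
pose k := s * (1 - 3 * s) / 2.
pose f : R -> R := s \*: (id - cst 1) + k \*: ((id - cst 1) ^+ 2)
  - (@powR R) ^~ (1 - s) + (@powR R) ^~ (1 - 2 * s).
pose df z : R := s + 2 * k * (z - 1) - (1 - s) * z `^ (1 - s - 1)
  + (1 - 2 * s) * z `^ (1 - 2 * s - 1).
have fdf z : 1 <= z <= 1 + y -> is_derive z 1 f (df z).
  move=> /andP[z1 _]; have z0 : 0 < z by lra.
  have ? := is_derive1_powR (1 - s) z0.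
  have ? := is_derive1_powR (1 - 2 * s) z0.
  apply: is_derive_eq; rewrite /df /GRing.scale/= !fctE /cst expr1; ring.
have [|c /andP[c1 _]] := mean_value R f df 1 (1 + y) _ fdf; first by lra.
have c0 : 0 < c by lra.
have fE w : f w = s * (w - 1) + k * (w - 1) ^+ 2 - w `^ (1 - s)
    + w `^ (1 - 2 * s) by [].
rewrite !fE /df !powR1 => E.
set p := c `^ (- s).
have p1 : p <= 1.
  by rewrite -(powRr0 c) ler_powR//; lra.
have pge : 1 - p <= s * (c - 1).
  have lnc := ln_le_subr1 R c c0.
  have := expR_ge1Dx (- s * ln c); rewrite -powR_expR// -/p; nra.
have e1 : c `^ (1 - s - 1) = p by congr (c `^ _); ring.
have e2 : c `^ (1 - 2 * s - 1) = p ^+ 2.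
  rewrite expr2 -powRD ?(gt_eqF c0) ?implybT//.
  by congr (c `^ _); ring.
(* This is [df c]: its last terms [s - (1 - s) p + (1 - 2 s) p^2] factor. *)
have df_ge0 : 0 <= s * (1 - 3 * s) * (c - 1) - (1 - p) * ((1 - 2 * s) * p - s).
  have le1 : (1 - p) * ((1 - 2 * s) * p - s) <= (1 - p) * (1 - 3 * s).
    by rewrite ler_wpM2l//; nra.
  have le2 : (1 - p) * (1 - 3 * s) <= s * (c - 1) * (1 - 3 * s).
    by rewrite ler_wpM2r//; lra.
  lra.
have : 0 <= (s * (1 - 3 * s) * (c - 1) - (1 - p) * ((1 - 2 * s) * p - s)) * y.
  by rewrite mulr_ge0//; lra.
move: E; rewrite e1 e2 -/k /k; lra.
Qed.

Lemma weight_profile_gt (R : realType) (s x y : R) : 0 < s <= 1 / 3 ->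
    0 < y -> y <= x -> x <= 1 ->
  s ^+ 2 * x < (1 - (1 - x) `^ s) / x
    - ((1 + y) `^ (1 - s) - (1 + y) `^ (1 - 2 * s)) / y.
Proof.
move=> s01 y0 yx x1; have /andP[s0 s1] := s01.
have x0 : 0 < x by lra.
have lo : s + s * (1 - s) / 2 * x < (1 - (1 - x) `^ s) / x.
  rewrite ltr_pdivlMr//.
  have := powR_lt_quadratic R s x; rewrite x0 x1 s0 => /(_ ltac:(lra) isT); lra.
have hi : ((1 + y) `^ (1 - s) - (1 + y) `^ (1 - 2 * s)) / y <=
    s + s * (1 - 3 * s) / 2 * y.
  rewrite ler_pdivrMr//.
  have := powR_sub_le_quadratic R s y s01 y0; lra.
(* At [y = x] the two linear terms differ by exactly s^2 x, since (1 - s) - (1 - 3s) = 2s. *)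
have : s * (1 - 3 * s) * y <= s * (1 - 3 * s) * x.
  by rewrite ler_wpM2l// mulr_ge0//; lra.
lra.
Qed.

(** * Partial sums and the pointwise bound on the weight *)

Section psum_weight.
Variables (R : realType) (alpha : R) (q : nat -> R).
Hypothesis q_gt0 : forall n : nat, (1 <= n)%N -> 0 < q n.
Local Notation Q := (psum q).
Local Notation v n := (Q n `^ alpha / q n).
Local Notation u n := (Q n `^ ((1 - alpha) / 2)).

Lemma psum0 : Q 0 = 0.
Proof. by rewrite /psum big_geq. Qed.

Lemma psumS n : Q n.+1 = Q n + q n.+1.
Proof. by rewrite /psum big_nat_recr. Qed.

Lemma psum_ge0 n : 0 <= Q n.
Proof.
elim: n => [|n IH]; first by rewrite psum0.
by rewrite psumS addr_ge0// ltW// q_gt0.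
Qed.

Lemma psum_gt0 n : 0 < Q n.+1.
Proof. by rewrite psumS ltr_wpDl ?psum_ge0 ?q_gt0. Qed.

Lemma weightE n : weight alpha q Q n.+1 =
  v n.+1 * (1 - u n / u n.+1) + v n.+2 * (1 - u n.+2 / u n.+1).
Proof.
have Q0 := psum_gt0 n; have q1 := q_gt0 n.+1 isT; have q2 := q_gt0 n.+2 isT.
have Qne : Q n.+1 != 0 by rewrite gt_eqF.
have un : u n / u n.+1 = (1 - q n.+1 / Q n.+1) `^ ((1 - alpha) / 2).
  have -> : 1 - q n.+1 / Q n.+1 = Q n / Q n.+1.
    by rewrite -{1}(divff Qne) -mulrBl psumS addrK.
  by rewrite powRM ?psum_ge0 ?invr_ge0 ?psum_ge0// -(powR_inv1 (psum_ge0 _))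
     -!powRrM mulN1r powRN.
have b0 : 0 <= 1 + q n.+2 / Q n.+1 by rewrite addr_ge0// divr_ge0 ?ltW.
have QS : Q n.+2 = Q n.+1 * (1 + q n.+2 / Q n.+1).
  by rewrite mulrDr mulr1 mulrCA divff// mulr1 -psumS.
have b_gt0 : 0 < 1 + q n.+2 / Q n.+1 by rewrite addr_gt0// divr_gt0.
have une : u n.+1 != 0 by rewrite gt_eqF// powR_gt0.
rewrite un /weight QS !powRM ?psum_ge0//.
have -> : (1 + alpha) / 2 = alpha + (1 - alpha) / 2 by field.
rewrite powRD; last by rewrite (gt_eqF b_gt0) implybT.
by field; rewrite une !gt_eqF.
Qed.

Lemma weight_gt n : 1 / 3 <= alpha -> alpha < 1 -> q n.+2 <= q n.+1 ->
  (alpha - 1) ^+ 2 / 4 * (q n.+1 / Q n.+1 `^ (2 - alpha))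
    < weight alpha q Q n.+1.
Proof.
move=> a3 a1 qle.
have Q0 := psum_gt0 n; have q1 := q_gt0 n.+1 isT; have q2 := q_gt0 n.+2 isT.
have s01 : 0 < (1 - alpha) / 2 <= 1 / 3 by apply/andP; lra.
have y0 : 0 < q n.+2 / Q n.+1 by exact: divr_gt0.
have yx : q n.+2 / Q n.+1 <= q n.+1 / Q n.+1 by rewrite ler_pM2r ?invr_gt0.
have x1 : q n.+1 / Q n.+1 <= 1.
  by rewrite ler_pdivrMr// mul1r psumS lerDr psum_ge0.
have := weight_profile_gt R _ _ _ s01 y0 yx x1.
have -> : 1 - 2 * ((1 - alpha) / 2) = alpha by field.
have -> : 1 - (1 - alpha) / 2 = (1 + alpha) / 2 by field.
have -> : Q n.+1 `^ (2 - alpha) = Q n.+1 ^+ 2 / Q n.+1 `^ alpha.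
  by rewrite powRB ?(gt_eqF Q0) ?implybT// powR_mulrn ?psum_ge0.
have P0 : 0 < Q n.+1 `^ alpha by rewrite powR_gt0.
(* The factor Q^alpha / Q turns x = q / Q into q / Q^(2 - alpha) and the profile into the weight. *)
rewrite -(ltr_pM2l (divr_gt0 P0 Q0)) /weight.
set a := (1 + _) `^ alpha; set b := (1 - _) `^ _; set c := (1 + _) `^ _.
congr (_ < _); first by field; rewrite !gt_eqF.
by field; rewrite !gt_eqF.
Qed.

End psum_weight.

(** * Edge inequality and summation *)

Lemma cmod_ge0 (R : realType) (z : R[i]) : 0 <= cmod z.
Proof. by case: z => a b; exact: sqrtr_ge0. Qed.

(** The reverse triangle inequality reduces to the moduli a and b; then 2ab <= t a^2 + b^2 / t, with
    gap (ta - b)^2 / t. *)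
Lemma cmod_sqrB_ge (R : realType) (z w : R[i]) (t : R) : 0 < t ->
  (1 - t) * cmod z ^+ 2 + (1 - t^-1) * cmod w ^+ 2 <= cmod (z - w) ^+ 2.
Proof.
move=> t0; have tri (x y : R[i]) : cmod x <= cmod (x - y) + cmod y.
  by rewrite -{1}(subrK y x) /cmod le_normcD.
have := tri z w; have := tri w z; rewrite -opprB /cmod normcN -!/(cmod _).
move: (cmod_ge0 _ z) (cmod_ge0 _ w) (cmod_ge0 _ (z - w)).
move: (cmod z) (cmod w) (cmod (z - w)) => a b d a0 b0 d0 h1 h2.
have h : (a - b) ^+ 2 <= d ^+ 2 by nra.
apply: le_trans h; rewrite -subr_ge0.
have -> : (a - b) ^+ 2 - ((1 - t) * a ^+ 2 + (1 - t^-1) * b ^+ 2) =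
  (t * a - b) ^+ 2 / t by field; rewrite gt_eqF.
by rewrite divr_ge0 ?sqr_ge0 ?ltW.
Qed.

Lemma lim_series_eventually0 (R : realType) (f : nat -> R) (N : nat) :
    (forall n, (N <= n)%N -> f n = 0) ->
  \sum_(1 <= n <oo) f n = \sum_(0 <= n < N) f n.+1.
Proof.
move=> f0; apply: lim_near_cst => //; near=> n.
have Nn : (N.+1 <= n)%N by near: n; exact: nbhs_infty_ge.
rewrite (@big_cat_nat _ _ _ N.+1)//= [X in _ + X]big1_seq ?addr0 => [|i].
  by rewrite big_add1.
by rewrite mem_index_iota => /andP[_ /andP[/ltnW Ni _]]; rewrite f0.
Unshelve. all: by end_near. Qed.

Section summation.
Variables (R : realType) (alpha : R) (A : nat -> R[i]) (q : nat -> R).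
Hypothesis alpha_lt1 : alpha < 1.
Hypothesis A0 : A 0%N = 0.
Hypothesis q_gt0 : forall n : nat, (1 <= n)%N -> 0 < q n.
Local Notation Q := (psum q).
Local Notation v n := (Q n `^ alpha / q n).
Local Notation u n := (Q n `^ ((1 - alpha) / 2)).

(* The subtracted term is the half of the weight at [N] that belongs to the
   edge [N, N + 1], which the right-hand side does not yet contain. *)
Lemma partial_hardy (N : nat) :
  \sum_(0 <= n < N) weight alpha q Q n.+1 * cmod (A n.+1) ^+ 2
    - v N.+1 * (1 - u N.+1 / u N) * cmod (A N) ^+ 2 <=
  \sum_(0 <= n < N) Q n.+1 `^ alpha * cmod (A n.+1 - A n) ^+ 2 / q n.+1.
Proof.
elim: N => [|N IH].
  by rewrite !big_geq// A0 /cmod ComplexField.Normc.normc0 expr0n mulr0 subr0.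
rewrite !big_nat_recr//= weightE//.
have v0 : 0 < v N.+1 by rewrite divr_gt0 ?powR_gt0 ?psum_gt0 ?q_gt0.
(* Cancelling the induction hypothesis leaves the single edge from [N] to [N.+1]. *)
suff : v N.+1 * ((1 - u N / u N.+1) * cmod (A N.+1) ^+ 2
    + (1 - u N.+1 / u N) * cmod (A N) ^+ 2)
    <= v N.+1 * cmod (A N.+1 - A N) ^+ 2 by move: IH; lra.
rewrite ler_pM2l//.
case: N {IH v0} => [|N].
  (* On the first edge the ratio t would be 0, but [A 0 = 0] and [u 0 = 0] make both sides equal. *)
  have s0 : 0 < (1 - alpha) / 2 by rewrite divr_gt0 ?subr_gt0.
  by rewrite A0 subr0 psum0 powR0 ?(gt_eqF s0)// mul0r subr0 mul1r /cmod
    ComplexField.Normc.normc0 expr0n mulr0 addr0.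
(* Taking t as the ratio of ground state values makes [1 - t] and [1 - t^-1] the two coefficients of
   the edge. *)
have t0 : 0 < u N.+1 / u N.+2 by rewrite divr_gt0 ?powR_gt0 ?psum_gt0.
by have := cmod_sqrB_ge R (A N.+2) (A N.+1) _ t0; rewrite invf_div.
Qed.

End summation.

(** The strict half asks for a nonzero entry, as both of its sides vanish for [A = 0]. *)
Theorem theorem3p3 (R : realType) (alpha : R) (A : nat -> R[i])
    (alpha_ge : 1 / 3 <= alpha) (alpha_lt1 : alpha < 1)
    (A_fin : finitely_supported A) (A0 : A 0%N = 0)
    (q : nat -> R)
    (q_gt0 : forall n : nat, (1 <= n)%N -> 0 < q n)
    (q_decr : forall n : nat, (1 <= n)%N -> q n.+1 <= q n) :
  let Q := psum q in
  \sum_(1 <= n <oo) (Q n `^ alpha * cmod (A n - A n.-1) ^+ 2 / q n)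
    >= \sum_(1 <= n <oo) (weight alpha q Q n * cmod (A n) ^+ 2)
  /\
  ((exists n : nat, A n != 0) ->
   \sum_(1 <= n <oo) (weight alpha q Q n * cmod (A n) ^+ 2)
     > (alpha - 1) ^+ 2 / 4
       * \sum_(1 <= n <oo) (q n / Q n `^ (2 - alpha) * cmod (A n) ^+ 2)).
Proof.
move=> Q.
have cmod0 (z : R[i]) : z = 0 -> cmod z = 0.
  by move=> ->; exact: ComplexField.Normc.normc0.
have [N AN] : exists N : nat, forall n, (N <= n)%N -> A n = 0.
  have /(@finite_seqP _ _)[s Es] := A_fin.
  exists (\max_(i <- s) i).+1 => n sn; apply/eqP; apply: contraTT sn => An.
  rewrite -leqNgt; apply: (@leq_bigmax_seq _ _ xpredT id) => //.
  by have : [set n | A n != 0] n by []; rewrite Es.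
have an0 n : (N <= n)%N -> cmod (A n) ^+ 2 = 0.
  by move=> Nn; rewrite cmod0 ?AN// expr0n.
(* The cutoff is [N.+1] because the difference at [n = N] may be nonzero; [A N.+1 = 0] then removes
   the boundary term of [partial_hardy]. *)
rewrite (@lim_series_eventually0 _ _ N.+1) => [|n /ltnW Nn]; last first.
  by rewrite an0 ?mulr0.
rewrite (@lim_series_eventually0 _ _ N.+1); last first.
  move=> n Nn; have Nn1 : (N <= n.-1)%N by case: n Nn.
  by rewrite (AN n (ltnW Nn)) (AN _ Nn1) subr0 cmod0// expr0n mulr0 mul0r.
rewrite (@lim_series_eventually0 _ _ N.+1) => [|n /ltnW Nn]; last first.
  by rewrite an0 ?mulr0.
split.
  have := partial_hardy R alpha A q alpha_lt1 A0 q_gt0 N.+1.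
  by rewrite (an0 N.+1)// mulr0 subr0.
case=> -[|m] Am; first by rewrite A0 eqxx in Am.
have mN : (m < N.+1)%N.
  by rewrite ltnS leqNgt; apply: contra Am => Nm; rewrite AN// ltnW// ltnW.
have wgt n := weight_gt R alpha q q_gt0 n alpha_ge alpha_lt1 (q_decr n.+1 isT).
(* The term at [m], where [A m.+1 != 0], gives strictness; the others are compared weakly. *)
rewrite mulr_sumr !big_mkord (bigD1 (Ordinal mN))//=.
rewrite [ltRHS](bigD1 (Ordinal mN))//=.
apply: ltr_leD.
  rewrite mulrA ltr_pM2r; first exact: wgt.
  rewrite exprn_gt0// lt_neqAle; apply/andP; split.
    rewrite eq_sym; apply: contra Am.
    by move=> /eqP/ComplexField.Normc.eq0_normc/eqP.
  exact: cmod_ge0.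
apply: ler_sum => i _; rewrite mulrA ler_wpM2r ?sqr_ge0//.
exact/ltW/wgt.
Qed.
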